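(* The theory of the structure $\langle\mathbb{R},0,1,-1,\cdot,{}^{-1},\mathcal{P}\rangle$ admits quantifier elimination.
   Context: $\mathbb{R}$ carries constants $0,1,-1$, ordinary multiplication, ${}^{-1}$ given by $x^{-1}=1/x$ for $x\neq 0$ and $0^{-1}=0$, and the unary predicate $\mathcal{P}(x)\iff x>0$. *)

(* Defs.v *)
From HB Require Import structures.
From mathcomp Require Import all_boot all_order all_algebra.
From mathcomp Require Import reals.

Set Implicit Arguments.
Unset Strict Implicit.
Unset Printing Implicit Defensive.

Import Order.TTheory GRing.Theory Num.Theory.

(* First-order logic with equality over the signature (0, 1, -1, *, ^-1, P).
   Variables are named by natural numbers. *)

Inductive term : Type :=
| Var of nat
| Zero
| One
| MinusOne
| Mul of term & term
| Inv of term.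

Inductive formula : Type :=
| Bot
| Eq of term & term
| Pos of term
| Not of formula
| And of formula & formula
| Or of formula & formula
| Imp of formula & formula
| All of nat & formula
| Ex of nat & formula.

Definition Iff (f g : formula) : formula := And (Imp f g) (Imp g f).

Fixpoint term_vars (t : term) : seq nat :=
  match t with
  | Var n => [:: n]
  | Zero | One | MinusOne => [::]
  | Mul t1 t2 => term_vars t1 ++ term_vars t2
  | Inv t1 => term_vars t1
  end.

Fixpoint free_vars (f : formula) : seq nat :=
  match f with
  | Bot => [::]
  | Eq t1 t2 => term_vars t1 ++ term_vars t2
  | Pos t => term_vars t
  | Not g => free_vars g
  | And g h | Or g h | Imp g h => free_vars g ++ free_vars h
  | All n g | Ex n g => [seq m <- free_vars g | m != n]
  end.

Fixpoint quantifier_free (f : formula) : bool :=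
  match f with
  | Bot | Eq _ _ | Pos _ => true
  | Not g => quantifier_free g
  | And g h | Or g h | Imp g h => quantifier_free g && quantifier_free h
  | All _ _ | Ex _ _ => false
  end.

Definition sentence (f : formula) : Prop := free_vars f = [::].

Record structure : Type := Structure {
  carrier :> Type;
  s_zero : carrier;
  s_one : carrier;
  s_mone : carrier;
  s_mul : carrier -> carrier -> carrier;
  s_inv : carrier -> carrier;
  s_pos : carrier -> Prop
}.

Definition update (T : Type) (v : nat -> T) (n : nat) (x : T) : nat -> T :=
  fun m => if m == n then x else v m.

Fixpoint eval (M : structure) (v : nat -> M) (t : term) : M :=
  match t with
  | Var n => v n
  | Zero => s_zero M
  | One => s_one M
  | MinusOne => s_mone M
  | Mul t1 t2 => s_mul (eval v t1) (eval v t2)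
  | Inv t1 => s_inv (eval v t1)
  end.

Fixpoint sat (M : structure) (v : nat -> M) (f : formula) : Prop :=
  match f with
  | Bot => False
  | Eq t1 t2 => eval v t1 = eval v t2
  | Pos t => s_pos (eval v t)
  | Not g => ~ sat v g
  | And g h => sat v g /\ sat v h
  | Or g h => sat v g \/ sat v h
  | Imp g h => sat v g -> sat v h
  | All n g => forall x : M, sat (update v n x) g
  | Ex n g => exists x : M, sat (update v n x) g
  end.

Definition valid_in (M : structure) (f : formula) : Prop :=
  forall v : nat -> M, sat v f.

Definition theory : Type := formula -> Prop.

Definition theory_of (M : structure) : theory :=
  fun f => sentence f /\ valid_in M f.

Definition model (M : structure) (T : theory) : Prop :=
  forall f, T f -> valid_in M f.

Definition entails (T : theory) (f : formula) : Prop :=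
  forall M : structure, model M T -> valid_in M f.

(* The inclusion of free variables expresses that, as usual, a formula
   f(x_1, ..., x_n) is equivalent modulo T to a quantifier-free formula
   g(x_1, ..., x_n) in the same variables. *)
Definition admits_QE (T : theory) : Prop :=
  forall f : formula, exists g : formula,
    [/\ quantifier_free g,
        {subset free_vars g <= free_vars f}
      & entails T (Iff f g)].

Local Open Scope ring_scope.

(* The inverse of a field in MathComp satisfies 0^-1 = 0 (invr0). *)
Definition real_structure (R : realType) : structure :=
  @Structure R 0 1 (-1) (fun x y => x * y) (fun x => x^-1) (fun x => 0 < x).

(* Main.v *)
Require Import Defs.
From HB Require Import structures.
From mathcomp Require Import all_boot all_order all_algebra.
From mathcomp Require Import reals.
From Stdlib Require List.
From mathcomp Require Import boolp.

(** To eliminate [Ex x f] with [f] quantifier-free, treat [x = 0], [x > 0] and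
    [x < 0] separately; the last case reduces to the second by replacing [x]
    with [-x].  For [x > 0] every term [t] equals [x ^ k * c], where [k] is the
    degree of [t] in [x] and [c] is [t] with [1] substituted for [x].  So the
    sign of [t] is that of [c], and an equation whose two sides have different
    degrees either is independent of [x] (when [c1 = 0]) or has the form
    [x ^ n = a] with [n != 0], which has exactly one positive solution if
    [a > 0] and none otherwise.  Either [x] is the solution of one of these
    equations, and then every other equation can be decided by raising it to
    the power [n], or [x] solves none of them, and such an [x] always exists. *)

Set Implicit Arguments.
Unset Strict Implicit.
Unset Printing Implicit Defensive.

Import Order.TTheory GRing.Theory Num.Theory.

Local Open Scope ring_scope.

(** * Integer powers in a real closed field *)

Section RealPowers.
Variable R : rcfType.
Implicit Types (a u w x : R) (n : int).

Lemma exists_exprz_root a n : 0 < a -> n != 0 -> exists2 x, 0 < x & x ^ n = a.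
Proof.
have root_nat (b : R) (m : nat) : 0 < b -> exists2 x, 0 < x & x ^+ m.+1 = b.
  move=> b_gt0.
  have b1_ge1 : 1 <= 1 + b by rewrite lerDl ltW.
  have b1_ge0 : 0 <= 1 + b by rewrite addr_ge0 // ltW.
  (* The right endpoint works because [b <= 1 + b <= (1 + b) ^+ m.+1]. *)
  have [|x /andP[x_ge0 _]] := @poly_ivt R ('X^(m.+1) - b%:P) 0 (1 + b) b1_ge0.
    rewrite !hornerE expr0n /= sub0r oppr_le0 ltW //= subr_ge0.
    by rewrite (le_trans _ (ler_eXnr _ b1_ge1)) // lerDr.
  rewrite rootE !hornerE subr_eq0 => /eqP xb; exists x => //.
  rewrite lt0r x_ge0 andbT; apply: contraTneq b_gt0 => x0.
  by rewrite -xb x0 expr0n ltxx.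
case: n => [[|m]|m] // a_gt0 _; first exact: root_nat.
(* [Negz m] stands for [-(m + 1)], so a root of [a^-1] is taken. *)
have [x x_gt0 xE] := root_nat a^-1 m (etrans (invr_gt0 _) a_gt0).
by exists x; rewrite // NegzE -exprnN xE invrK.
Qed.

(** Even powers confuse opposite numbers. The sign condition puts [u] and [w] both among the
    positive or both among the nonpositive elements, and the power map is injective on each of these
    half-lines. *)
Lemma exprz_inj_sign u w n :
  n != 0 -> u ^ n = w ^ n -> (0 < u <-> 0 < w) -> u = w.
Proof.
move=> n0 uw [sgn_uw sgn_wu]; have [u_gt0|u_le0] := ltP 0 u.
  by apply/eqP; rewrite -(eqrXz2 n0) ?ltW ?sgn_uw // uw.
have w_le0 : w <= 0 by case: leP => // /sgn_wu; rewrite ltNge u_le0.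
exact: (nexpIrz n0) u_le0 w_le0 uw.
Qed.

Lemma exprz_avoid (T : Type) (s : list T) (a : T -> R) (n : T -> int) :
  exists2 x, 0 < x &
    forall e, List.In e s -> n e != 0 -> x ^ n e <> a e.
Proof.
(* Each equation has at most one positive solution, so every [x] beyond some bound avoids them all.
   The induction enlarges the bound. *)
suff [M M_ge0 MP] : exists2 M, 0 <= M & forall x, M < x ->
    forall e, List.In e s -> n e != 0 -> x ^ n e <> a e.
  by exists (M + 1); [rewrite ltr_wpDl | apply: MP; rewrite ltrDl].
elim: s => [|e s [M M_ge0 IH]]; first by exists 0.
have [[x0 [x0_gt0 n0 x0E]]|no_root] :=
  EM (exists x0, [/\ 0 < x0, n e != 0 & x0 ^ n e = a e]).
  exists (Num.max M x0); first by rewrite le_max M_ge0.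
  move=> x; rewrite gt_max => /andP[Mx x0x] e' [<-|]; last exact: IH.
  move=> _; rewrite -x0E => /eqP.
  have x_gt0 := lt_trans x0_gt0 x0x.
  by rewrite (eqrXz2 n0) ?ltW // (gt_eqF x0x).
exists M => // x Mx e' [<-|]; last exact: IH.
by move=> n0 xE; apply: no_root; exists x; rewrite (le_lt_trans M_ge0).
Qed.

End RealPowers.

(** * Dependence of truth on the free variables *)

Section Logic.
Variable M : structure.
Implicit Types (v w : nat -> M) (t : term) (f g : formula).

Lemma update_id v n : update v n (v n) = v.
Proof. by apply: funext => m; rewrite /update; case: eqP => [->|]. Qed.

Lemma update_update v n (x y : M) :
  update (update v n x) n y = update v n y.
Proof. by apply: funext => m; rewrite /update; case: eqP. Qed.

Lemma eq_eval v w t : {in term_vars t, v =1 w} -> eval v t = eval w t.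
Proof.
elim: t => //= [n|t1 IH1 t2 IH2|t IH] vw; last by rewrite IH.
  by apply: vw; rewrite inE.
by rewrite IH1 ?IH2 // => n nt; apply: vw; rewrite mem_cat nt ?orbT.
Qed.

Lemma eq_sat v w f : {in free_vars f, v =1 w} -> (sat v f <-> sat w f).
Proof.
elim: f v w => //= [t1 t2|t|f IH|f IHf g IHg|f IHf g IHg|f IHf g IHg
  |n f IH|n f IH] v w vw.
- by rewrite (@eq_eval v w t1) ?(@eq_eval v w t2) // => n nt;
    apply: vw; rewrite mem_cat nt ?orbT.
- by rewrite (@eq_eval v w t).
- by rewrite (IH v w).
- by rewrite (IHf v w) ?(IHg v w) // => n nt;
    apply: vw; rewrite mem_cat nt ?orbT.
- by rewrite (IHf v w) ?(IHg v w) // => n nt;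
    apply: vw; rewrite mem_cat nt ?orbT.
- by rewrite (IHf v w) ?(IHg v w) // => n nt;
    apply: vw; rewrite mem_cat nt ?orbT.
- have upd x : {in free_vars f, update v n x =1 update w n x}.
    move=> m mf; rewrite /update; case: eqP => // /eqP mn.
    by apply: vw; rewrite mem_filter mn.
  by split=> H x; apply/(IH _ _ (upd x)).
- have upd x : {in free_vars f, update v n x =1 update w n x}.
    move=> m mf; rewrite /update; case: eqP => // /eqP mn.
    by apply: vw; rewrite mem_filter mn.
  by split=> -[x H]; exists x; apply/(IH _ _ (upd x)).
Qed.

End Logic.

(** * From validity in a structure to consequences of its theory *)

Definition closure (f : formula) : formula := foldr All f (free_vars f).

Lemma sentence_closure f : sentence (closure f).
Proof.
have fvE s : free_vars (foldr All f s) = [seq m <- free_vars f | m \notin s].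
  elim: s => [|n s IH] /=; first by rewrite filter_predT.
  rewrite IH -filter_predI; apply: eq_filter => m /=.
  by rewrite inE negb_or.
rewrite /sentence /closure fvE (@eq_in_filter _ _ pred0) ?filter_pred0 //.
by move=> m ->.
Qed.

Lemma valid_in_closure (M : structure) f :
  valid_in M (closure f) <-> valid_in M f.
Proof.
rewrite /closure; elim: (free_vars f) => //= n s <-; split=> H v.
  by have := H v (v n); rewrite update_id.
by move=> x; apply: H.
Qed.

(** The theory contains sentences only, so [f] enters it through its universal closure. *)
Lemma entails_theory_of (M : structure) f :
  valid_in M f -> entails (theory_of M) f.
Proof.
move=> Mf N modN; apply/valid_in_closure/modN.
by split; [apply: sentence_closure | apply/valid_in_closure].
Qed.

(** * Substitution in quantifier-free formulas *)

Fixpoint tsubst (s : nat -> term) (t : term) : term :=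
  match t with
  | Var n => s n
  | Mul t1 t2 => Mul (tsubst s t1) (tsubst s t2)
  | Inv t1 => Inv (tsubst s t1)
  | _ => t
  end.

(* Meant for quantifier-free formulas only: quantified subformulas are left
   unchanged. *)
Fixpoint fsubst (s : nat -> term) (f : formula) : formula :=
  match f with
  | Eq t1 t2 => Eq (tsubst s t1) (tsubst s t2)
  | Pos t => Pos (tsubst s t)
  | Not g => Not (fsubst s g)
  | And g h => And (fsubst s g) (fsubst s h)
  | Or g h => Or (fsubst s g) (fsubst s h)
  | Imp g h => Imp (fsubst s g) (fsubst s h)
  | _ => f
  end.

Section Substitution.
Variables (M : structure) (s : nat -> term).
Implicit Types (v : nat -> M) (t : term) (f : formula).

Lemma eval_tsubst v t :
  eval v (tsubst s t) = eval (fun n => eval v (s n)) t.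
Proof. by elim: t => //= [t1 -> t2 ->|t ->]. Qed.

Lemma sat_fsubst v f : quantifier_free f ->
  (sat v (fsubst s f) <-> sat (fun n => eval v (s n)) f).
Proof.
elim: f => //= [t1 t2|t|f IH|f IHf g IHg|f IHf g IHg|f IHf g IHg].
- by rewrite !eval_tsubst.
- by rewrite eval_tsubst.
- by move=> /IH ->.
- by move=> /andP[/IHf -> /IHg ->].
- by move=> /andP[/IHf -> /IHg ->].
- by move=> /andP[/IHf -> /IHg ->].
Qed.

Lemma quantifier_free_fsubst f :
  quantifier_free (fsubst s f) = quantifier_free f.
Proof. by elim: f => //= f -> g ->. Qed.

(** Applied once, at the very end, this spares tracking free variables through the elimination. *)
Lemma free_vars_fsubst (A : {pred nat}) f :
  (forall n, {subset term_vars (s n) <= A}) ->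
  quantifier_free f -> {subset free_vars (fsubst s f) <= A}.
Proof.
move=> sA.
have tA t : {subset term_vars (tsubst s t) <= A}.
  elim: t => //= t1 IH1 t2 IH2 n.
  by rewrite mem_cat => /orP[/IH1|/IH2].
elim: f => //= [t1 t2 _ n|f IHf g IHg|f IHf g IHg|f IHf g IHg].
- by rewrite mem_cat => /orP[/tA|/tA].
- by move=> /andP[/IHf fA /IHg gA] n; rewrite mem_cat => /orP[/fA|/gA].
- by move=> /andP[/IHf fA /IHg gA] n; rewrite mem_cat => /orP[/fA|/gA].
- by move=> /andP[/IHf fA /IHg gA] n; rewrite mem_cat => /orP[/fA|/gA].
Qed.

End Substitution.

Definition subst1 (x : nat) (t : term) : nat -> term :=
  fun n => if n == x then t else Var n.

Lemma eval_subst1 (M : structure) (v : nat -> M) x t :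
  (fun n => eval v (subst1 x t n)) = update v x (eval v t).
Proof.
by apply: funext => n; rewrite /subst1 /update; case: eqP.
Qed.

(** * Eliminating one existential quantifier: the formulas *)

Section Elimination.
Variable x : nat.

(** [Zero] may have degree 0, since its coefficient vanishes anyway. *)
Fixpoint tdeg (t : term) : int :=
  match t with
  | Var n => if n == x then 1 else 0
  | Mul t1 t2 => tdeg t1 + tdeg t2
  | Inv t1 => - tdeg t1
  | _ => 0
  end.

Definition tcoef (t : term) : term := tsubst (subst1 x One) t.

Definition tpow (t : term) (k : int) : term :=
  match k with
  | Posz n => iter n (Mul t) One
  | Negz n => Inv (iter n.+1 (Mul t) One)
  end.

Fixpoint equations (f : formula) : list (term * term) :=
  match f with
  | Eq t1 t2 => [:: (t1, t2)]
  | Not g => equations g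
  | And g h | Or g h | Imp g h => equations g ++ equations h
  | _ => [::]
  end.

Fixpoint replace_equations (F : term -> term -> formula) (f : formula) :=
  match f with
  | Eq t1 t2 => F t1 t2
  | Pos t => Pos (tcoef t)
  | Not g => Not (replace_equations F g)
  | And g h => And (replace_equations F g) (replace_equations F h)
  | Or g h => Or (replace_equations F g) (replace_equations F h)
  | Imp g h => Imp (replace_equations F g) (replace_equations F h)
  | _ => f
  end.

(** With different degrees, an [x > 0] that avoids the root equation satisfies [t1 = t2] only if
    both sides vanish. *)
Definition eq_generic (t1 t2 : term) : formula :=
  if tdeg t1 == tdeg t2 then Eq (tcoef t1) (tcoef t2)
  else And (Eq (tcoef t1) Zero) (Eq (tcoef t2) Zero).

(* The equation [t1 = t2] for the positive [x] such that [x ^ n = a].  Raising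
   to the power [n] may lose the sign, hence the second conjunct. *)
Definition eq_at_root (a : term) (n : int) (t1 t2 : term) : formula :=
  And (Eq (Mul (tpow a (tdeg t1 - tdeg t2)) (tpow (tcoef t1) n))
          (tpow (tcoef t2) n))
      (Iff (Pos (tcoef t1)) (Pos (tcoef t2))).

(** If the left coefficient is 0, this takes the value 0 because [0^-1 = 0], and the positivity test
    in [at_root] then rejects the equation. *)
Definition root_value (e : term * term) : term :=
  Mul (tcoef e.2) (Inv (tcoef e.1)).

Definition root_exponent (e : term * term) : int := tdeg e.1 - tdeg e.2.

Definition at_root (f : formula) (e : term * term) : formula :=
  if root_exponent e == 0 then Bot
  else And (Pos (root_value e))
         (replace_equations (eq_at_root (root_value e) (root_exponent e)) f).

Definition elim_pos (f : formula) : formula :=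
  Or (replace_equations eq_generic f)
     (foldr (fun e => Or (at_root f e)) Bot (equations f)).

Definition elim_ex (f : formula) : formula :=
  Or (fsubst (subst1 x Zero) f)
     (Or (elim_pos f)
         (elim_pos (fsubst (subst1 x (Mul MinusOne (Var x))) f))).

Lemma quantifier_free_replace F f :
  (forall t1 t2, quantifier_free (F t1 t2)) -> quantifier_free f ->
  quantifier_free (replace_equations F f).
Proof.
move=> qF; elim: f => //= f IHf g IHg /andP[/IHf -> /IHg ->] //.
Qed.

Lemma quantifier_free_elim_pos f :
  quantifier_free f -> quantifier_free (elim_pos f).
Proof.
move=> qf /=; rewrite quantifier_free_replace //=; last first.
  by move=> t1 t2; rewrite /eq_generic; case: ifP.
elim: (equations f) => //= e s ->; rewrite andbT /at_root.
by case: ifP => //= _; apply: quantifier_free_replace.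
Qed.

Lemma quantifier_free_elim_ex f :
  quantifier_free f -> quantifier_free (elim_ex f).
Proof.
move=> qf; have qsub s : quantifier_free (fsubst s f).
  by rewrite quantifier_free_fsubst.
apply/and3P; split; first exact: qsub.
  exact: quantifier_free_elim_pos.
exact/quantifier_free_elim_pos/qsub.
Qed.

(** * Correctness of the elimination over the reals *)

Section Semantics.
Variable R : realType.
Local Notation RR := (real_structure R).
Local Notation reval := (@eval RR).
Local Notation rsat := (@sat RR).
Local Notation upd := (@update R).
Implicit Types (v : nat -> R) (y : R).

Lemma eval_tpow v t (k : int) : reval v (tpow t k) = (reval v t : R) ^ k.
Proof.
have powE n : reval v (iter n (Mul t) One) = (reval v t : R) ^+ n.
  by elim: n => //= n ->; rewrite exprS.
by case: k => n; rewrite [LHS]/= powE // -exprS.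
Qed.

(** At [y = 0] this fails for [x * x^-1], which has degree 0 and coefficient 1 but value 0; hence
    the separate treatment of zero. *)
Lemma eval_tcoef v y t : y != 0 ->
  reval (upd v x y) t = y ^ tdeg t * (reval v (tcoef t) : R).
Proof.
move=> y0; rewrite /tcoef eval_tsubst eval_subst1.
elim: t => /= [n||||t1 -> t2 ->|t ->]; rewrite ?expr0z ?mul1r //.
- rewrite /update; case: eqP => _ /=; first by rewrite expr1z mulr1.
  by rewrite expr0z mul1r.
- by rewrite expfzDr // mulrACA.
- by rewrite invfM invr_expz.
Qed.

Lemma sat_replace v y F f : 0 < y -> quantifier_free f ->
  (forall t1 t2, List.In (t1, t2) (equations f) ->
     (rsat v (F t1 t2) <-> rsat (upd v x y) (Eq t1 t2))) ->
  (rsat v (replace_equations F f) <-> rsat (upd v x y) f).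
Proof.
move=> y_gt0.
elim: f => //= [t1 t2|t|f IH|f IHf g IHg|f IHf g IHg|f IHf g IHg].
- by move=> _; apply; left.
- by move=> _ _; rewrite eval_tcoef ?gt_eqF // pmulr_rgt0 ?exprz_gt0.
- by move=> /IH{}IH H; rewrite IH.
- move=> /andP[/IHf{}IHf /IHg{}IHg] H.
  by rewrite IHf ?IHg // => t1 t2 ?; apply: H; apply/List.in_or_app; tauto.
- move=> /andP[/IHf{}IHf /IHg{}IHg] H.
  by rewrite IHf ?IHg // => t1 t2 ?; apply: H; apply/List.in_or_app; tauto.
- move=> /andP[/IHf{}IHf /IHg{}IHg] H.
  by rewrite IHf ?IHg // => t1 t2 ?; apply: H; apply/List.in_or_app; tauto.
Qed.

Lemma equation_tcoef v y t1 t2 : 0 < y ->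
  (rsat (upd v x y) (Eq t1 t2) <->
   y ^ (tdeg t1 - tdeg t2) * (reval v (tcoef t1) : R) = reval v (tcoef t2)).
Proof.
move=> y_gt0; have y0 : y != 0 by rewrite gt_eqF.
rewrite /= !eval_tcoef // expfzDr // -invr_expz.
have yk0 := expfz_neq0 (tdeg t2) y0.
split=> [E|<-]; last by rewrite mulrA mulrCA divff // mulr1.
by rewrite mulrAC E mulrAC divff // mul1r.
Qed.

(** Raising [y ^ k * c1 = c2] to the power [n] turns [y ^ k] into [a ^ k], which no longer mentions
    [y]. Conversely [y ^ k > 0], so comparing the signs of [c1] and [c2] allows [exprz_inj_sign] to
    undo the power. *)
Lemma sat_eq_at_root v y a (n : int) t1 t2 :
  0 < y -> n != 0 -> y ^ n = reval v a ->
  (rsat v (eq_at_root a n t1 t2) <-> rsat (upd v x y) (Eq t1 t2)).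
Proof.
move=> y_gt0 n0 ya; rewrite equation_tcoef //= !eval_tpow -ya.
rewrite (exprzAC y) -expfzMl; set k := tdeg t1 - tdeg t2.
have yk_gt0 : 0 < y ^ k by rewrite exprz_gt0.
split=> [[E [sgn12 sgn21]]|<-]; last by rewrite pmulr_rgt0.
by apply: (exprz_inj_sign n0 E); rewrite pmulr_rgt0.
Qed.

Lemma sat_eq_generic v y t1 t2 : 0 < y ->
  (root_exponent (t1, t2) != 0 ->
     y ^ root_exponent (t1, t2) <> reval v (root_value (t1, t2))) ->
  (rsat v (eq_generic t1 t2) <-> rsat (upd v x y) (Eq t1 t2)).
Proof.
move=> y_gt0; rewrite equation_tcoef // /eq_generic -[tdeg t1 == _]subr_eq0.
rewrite /root_exponent /root_value /=.
case: eqVneq => [-> _|_ /(_ isT) y_avoid] /=.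
  by rewrite expr0z mul1r.
split=> [[-> ->]|E]; first by rewrite mulr0.
(* A nonzero coefficient [c1] would give [y ^ k = c2 / c1], which is the excluded root equation. *)
have [c0|c0] := eqVneq (reval v (tcoef t1) : R) 0.
  by rewrite -E c0 mulr0.
by case: y_avoid; rewrite -E mulfK.
Qed.

Lemma sat_big_or v (F : term * term -> formula) s :
  rsat v (foldr (fun e => Or (F e)) Bot s) <->
  exists2 e, List.In e s & rsat v (F e).
Proof.
elim: s => [|e s IH] /=; first by split=> // -[].
rewrite IH; split=> [[?|[e' ? ?]]|[e' [<-|?] ?]]; first by exists e; [left|].
- by exists e'; [right|].
- by left.
- by right; exists e'.
Qed.

Lemma sat_elim_pos v f : quantifier_free f ->
  (rsat v (elim_pos f) <-> exists2 y, 0 < y & rsat (upd v x y) f).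
Proof.
move=> qf; rewrite /elim_pos [rsat _ _]/= sat_big_or; split.
  case=> [satf|[e _]].
    have [y y_gt0 y_avoid] := exprz_avoid (equations f)
      (fun e => reval v (root_value e) : R) root_exponent.
    exists y => //; apply: (iffLR (sat_replace y_gt0 qf _) satf) => t1 t2 ef.
    by apply: sat_eq_generic => //; apply: y_avoid.
  rewrite /at_root; case: eqVneq => // n0 [a_gt0 satf].
  have [y y_gt0 yE] := exists_exprz_root a_gt0 n0.
  exists y => //; apply: (iffLR (sat_replace y_gt0 qf _) satf) => t1 t2 _.
  exact: sat_eq_at_root.
case=> y y_gt0 satf.
(* Either the witness is the root of some equation of [f], which selects the disjunct [at_root f e],
   or it avoids all of them and the generic disjunct holds. *)
have [[e ef [n0 yE]]|no_root] := EM (exists2 e, List.In e (equations f) &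
    root_exponent e != 0 /\ y ^ root_exponent e = reval v (root_value e)).
  right; exists e => //; rewrite /at_root (negPf n0); split.
    by have := exprz_gt0 (root_exponent e) y_gt0; rewrite yE.
  apply: (iffRL (sat_replace y_gt0 qf _) satf) => t1 t2 _.
  exact: sat_eq_at_root.
left; apply: (iffRL (sat_replace y_gt0 qf _) satf) => t1 t2 ef.
by apply: sat_eq_generic => // n0 yE; apply: no_root; exists (t1, t2).
Qed.

Lemma sat_elim_ex v f : quantifier_free f ->
  (rsat v (elim_ex f) <-> rsat v (Ex x f)).
Proof.
have satOr g h : rsat v (Or g h) <-> rsat v g \/ rsat v h by [].
move=> qf; rewrite /elim_ex 2!satOr.
rewrite !sat_elim_pos ?quantifier_free_fsubst // sat_fsubst // eval_subst1.
(* Substituting [-x] for [x] carries negative witnesses to positive ones. *)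
have oppE y : rsat (upd v x y) (fsubst (subst1 x (Mul MinusOne (Var x))) f)
    <-> rsat (upd v x (- y)) f.
  by rewrite sat_fsubst // eval_subst1 update_update /= /update eqxx mulN1r.
split=> [[?|[[y _ ?]|[y _ /oppE ?]]]|[y satf]].
- by exists 0.
- by exists y.
- by exists (- y).
have [y_lt0|y_gt0|y0] := ltgtP y 0.
- right; right; exists (- y); first by rewrite oppr_gt0.
  by apply/oppE; rewrite opprK.
- by right; left; exists y.
- by left; rewrite /= -y0.
Qed.

End Semantics.
End Elimination.

(** * Eliminating all quantifiers *)

Lemma real_quantifier_elimination (R : realType) (f : formula) :
  exists2 g, quantifier_free g &
    forall v : nat -> R, @sat (real_structure R) v f
      <-> @sat (real_structure R) v g.
Proof.
elim: f => [|t1 t2|t|f [f' qf fE]|f [f' qf fE] g [g' qg gE]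
  |f [f' qf fE] g [g' qg gE]|f [f' qf fE] g [g' qg gE]
  |n f [f' qf fE]|n f [f' qf fE]].
- by exists Bot.
- by exists (Eq t1 t2).
- by exists (Pos t).
- by exists (Not f') => // v /=; rewrite fE.
- by exists (And f' g') => [|v] /=; rewrite ?qf // fE gE.
- by exists (Or f' g') => [|v] /=; rewrite ?qf // fE gE.
- by exists (Imp f' g') => [|v] /=; rewrite ?qf // fE gE.
- exists (Not (elim_ex n (Not f'))) => [|v].
    exact: (@quantifier_free_elim_ex n (Not f')).
  have exE := @sat_elim_ex n R v (Not f') qf; split=> [H /exE[y]|H y].
    by apply; apply/fE/H.
  by apply/fE; apply: contrapT => H'; apply: H; apply/exE; exists y.
- exists (elim_ex n f') => [|v]; first exact: quantifier_free_elim_ex.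
  by rewrite sat_elim_ex //; split=> -[y H]; exists y; apply/fE.
Qed.

Theorem theorem9 (R : realType) : admits_QE (theory_of (real_structure R)).
Proof.
move=> f; have [g qg fgE] := real_quantifier_elimination R f.
(* The truth of [f] does not depend on the variables outside [free_vars f], so
   they may be set to 1 in [g]. *)
pose s n := if n \in free_vars f then Var n else One.
exists (fsubst s g); split; first by rewrite quantifier_free_fsubst.
  apply: free_vars_fsubst qg => n m; rewrite /s.
  by case: ifP => //= nf; rewrite inE => /eqP ->.
apply: entails_theory_of => v.
suff fE : sat v f <-> sat v (fsubst s g) by rewrite /=; tauto.
rewrite sat_fsubst // -fgE; apply: eq_sat => n nf.
by rewrite /s nf.
Qed.
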